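(* Let $r\in\mathbb{N}$ and $\ell\in\mathbb{N}$, put $\zeta_\ell=e^{2\pi \mathbf{i}/\ell}$, and suppose there exists a collection of closed precycles $Z^r_{\ell,a}\in N^r_{\mathbb{R}}(\mathbb{Q}(\zeta_\ell),2r-1)$, $0\le a\le \ell-1$, with $$\mathscr{R}(Z^r_{\ell,a})=(r-1)!\,\ell^{r-1}\,\mathrm{Li}_r(\zeta_\ell^a).$$ Let $f:\mathbb{Z}/\ell\mathbb{Z}\to\mathbb{Z}$ satisfy $f(-a)=(-1)^r f(a)$ for all $a$, and set $Z:=\sum_{a=0}^{\ell-1} f(a)\, Z^r_{\ell,a}$. Then $AJ(Z)=\mathscr{R}(Z)\in \mathbb{C}/(2\pi\mathbf{i})^r\mathbb{Z}$ is torsion, of order given by the denominator (in lowest terms) of the rational number $$\tau(Z):=\left|(2\pi\mathbf{i})^{-r}\mathscr{R}(Z)\right| = \pm\frac{\ell^{r-1}}{2r}\sum_{a=0}^{\ell-1} f(a)\,B_r\!\left(\tfrac{a}{\ell}\right).$$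
   Context: Here $\mathbf{i}=\sqrt{-1}$, $\mathrm{Li}_r(z)=\sum_{k\ge1}z^k/k^r$, and $B_r(x)$ is the $r$-th Bernoulli polynomial ($B_2(x)=x^2-x+\frac16$, $B_3(x)=x^3-\frac32x^2+\frac12x$, $B_4(x)=x^4-2x^3+x^2-\frac1{30}$, etc.). Higher Chow precycles. Let $k\subset\mathbb{C}$ be a number field. Put $\square^n=(\mathbb{P}^1\setminus\{1\})^n$ with coordinates $z_1,\dots,z_n$; its faces are the subvarieties obtained by setting some of the $z_i$ equal to $0$ or $\infty$. Let $c^p(k,n)$ be the group of codimension-$p$ algebraic cycles on $\square^n_k$ meeting all faces properly, $d^p(k,n)$ the subgroup of cycles ''constant'' in some $z_i$ (degenerate cycles, i.e. pulled back along a coordinate projection $\square^n\to\square^{n-1}$), and $Z^p(k,n)=c^p(k,n)/d^p(k,n)$. The boundary is $\partial Z=\sum_{i=1}^n(-1)^i(Z\cdot\{z_i=\infty\}-Z\cdot\{z_i=0\})$. Normalized precycles are $N^p(k,n)=\{Z\in Z^p(k,n): Z\cdot\{z_i=0\}=Z\cdot\{z_i=\infty\}=0\ \text{for all } i<n\}$. A precycle $Z$ is closed if $\partial Z=0$. $\mathbb{R}$-proper precycles. Let $T_{z_i}=\{z_i\in\mathbb{R}_{<0}\}$, the branch cut of $\log(z_i)$. $Z^p_{\mathbb{R}}(k,n)\subset Z^p(k,n)$ consists of the precycles $Z$ whose associated analytic cycle $Z^{\mathrm{an}}$ properly intersects the various combinations (intersections) of the $T_{z_i}$ and the $\{z_j=0\},\{z_j=\infty\}$,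 and $N^p_{\mathbb{R}}(k,n)=Z^p_{\mathbb{R}}(k,n)\cap N^p(k,n)$. Regulator. Define currents on $(\mathbb{P}^1)^n$ recursively by $R_1=\log(z_1)$ and $$R_n=\log(z_1)\tfrac{dz_2}{z_2}\wedge\cdots\wedge\tfrac{dz_n}{z_n}-(-1)^n(2\pi\mathbf{i})\,R_{n-1}\cdot\delta_{T_{z_1}},$$ where $R_{n-1}$ is taken in the variables $z_2,\dots,z_n$, $\log$ has its branch cut along $\mathbb{R}_{<0}$, and $\delta_{T_{z_1}}$ is the (degree one) current of integration along $T_{z_1}$. (For instance $R_3=\log(z_1)\frac{dz_2}{z_2}\wedge\frac{dz_3}{z_3}+2\pi\mathbf{i}\log(z_2)\frac{dz_3}{z_3}\cdot\delta_{T_{z_1}}+(2\pi\mathbf{i})^2\log(z_3)\,\delta_{T_{z_1}\cap T_{z_2}}$.) For closed $Z\in N^r_{\mathbb{R}}(k,2r-1)$ set $$\mathscr{R}(Z)=\frac{1}{(2\pi\mathbf{i})^{r-1}}\int_{Z}R_{2r-1}\in\mathbb{C}/(2\pi\mathbf{i})^r\mathbb{Z};$$ this is the value $AJ(Z)$ of the integral Abel–Jacobi map $AJ^{r,2r-1}_{\mathbb{Z}}$ on the class of $Z$. Equalities of values of $\mathscr{R}$ are understood in $\mathbb{C}/(2\pi\mathbf{i})^r\mathbb{Z}$, so $(2\pi\mathbf{i})^{-r}\mathscr{R}(Z)$ and $\tau(Z)$ are understood up to adding integers (and $\tau(Z)$ up to sign), which does not affect the denominator. *)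

(* Defs.v *)
From HB Require Import structures.
From mathcomp Require Import all_boot all_order all_algebra all_field.
From mathcomp Require Import complex.
From mathcomp Require Import -(notations) freeg mpoly.
From mathcomp Require Import all_classical all_reals all_analysis.

Set Implicit Arguments.
Unset Strict Implicit.
Unset Printing Implicit Defensive.

Import Order.TTheory GRing.Theory Num.Theory.
Import numFieldNormedType.Exports.

Local Open Scope classical_set_scope.
Local Open Scope ring_scope.
Local Open Scope complex_scope.

(** * Ideals *)

Section Ideals.
Context {A : comNzRingType}.
Implicit Types I J P S : set A.

Definition is_ideal I : Prop :=
  [/\ I 0, forall a b, I a -> I b -> I (a + b) & forall a b, I b -> I (a * b)].

Definition is_prime_ideal P : Prop :=
  [/\ is_ideal P, ~ P 1 & forall a b, P (a * b) -> P a \/ P b].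

Definition ideal_generated S : set A :=
  [set x | forall I, is_ideal I -> S `<=` I -> I x].

Definition height_ge P (h : nat) : Prop :=
  exists Q : nat -> set A,
    [/\ forall i, (i <= h)%N -> is_prime_ideal (Q i),
        forall i, (i < h)%N -> Q i `<` Q i.+1 & Q h = P].

Definition has_height P (h : nat) : Prop := height_ge P h /\ ~ height_ge P h.+1.

Definition minimal_prime J P : Prop :=
  [/\ is_prime_ideal P, J `<=` P &
      forall Q, is_prime_ideal Q -> J `<=` Q -> Q `<=` P -> Q = P].

(* The ideals of the localization A_P containing J A_P correspond to the ideals
   K of A containing J with [s q \in K -> q \in K] for s outside P. *)
Definition local_ideal J P (K : set A) : Prop :=
  [/\ is_ideal K, J `<=` K & forall s q, ~ P s -> K (s * q) -> K q].

Definition local_length_ge J P (N : nat) : Prop :=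
  exists K : nat -> set A,
    (forall i, (i <= N)%N -> local_ideal J P (K i)) /\
    (forall i, (i < N)%N -> K i `<` K i.+1).

(* The length of the ring (A / J)_P. *)
Definition local_length J P : nat :=
  xget 0%N [set N | local_length_ge J P N /\ ~ local_length_ge J P N.+1].

End Ideals.

(** * Cubical cycles

   The coordinate [t = z / (z - 1)] identifies P^1 minus {1} with the affine line;
   z = 0 becomes t = 0, z = oo becomes t = 1, and z = t / (t - 1).  So the n-cube over
   k is Spec k[t_1, ..., t_n], its integral closed subschemes are the prime ideals of
   that ring, and an algebraic cycle is an element of the free abelian group on them.
   The face selected by [b : bool] in direction i (z_i = 0 for false, z_i = oo for true)
   is t_i = b. *)

Notation cubical_cycle k n :=
  (FreegDefs.type_of (Phant int) (Phant (set (mpoly n k)))).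

Section Cycles.
Context {k : fieldType}.

Definition tvar {n} (i : 'I_n) : mpoly n k := mpolyX k (mnm1 i).

(* A face is given by a partial assignment of values 0, oo to the coordinates. *)
Definition face_codim {n} (F : 'I_n -> option bool) : nat := #|[pred i | isSome (F i)]|.

Definition in_face {n} (F : 'I_n -> option bool) (Q : set (mpoly n k)) : Prop :=
  forall i (b : bool), F i = Some b -> Q (tvar i - b%:R).

(* Every component of the intersection with a face has codimension >= p in the face. *)
Definition meets_faces_properly {n} (p : nat) (P : set (mpoly n k)) : Prop :=
  forall (F : 'I_n -> option bool) (Q : set (mpoly n k)),
    is_prime_ideal Q -> P `<=` Q -> in_face F Q -> height_ge Q (p + face_codim F).

(* Z lies in c^p(k,n). *)
Definition in_c {n} (p : nat) (Z : cubical_cycle k n) : Prop :=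
  forall P, P \in dom Z ->
    [/\ is_prime_ideal P, has_height P p & meets_faces_properly p P].

Definition constant_in {n} (i : 'I_n) (q : mpoly n k) : Prop :=
  forall m, m \in msupp q -> m i = 0%N.

(* The subvariety is the preimage of a subvariety of the (n-1)-cube under the
   projection forgetting the i-th coordinate, for some i. *)
Definition degenerate {n} (P : set (mpoly n k)) : Prop :=
  exists i : 'I_n, P = ideal_generated (P `&` constant_in i).

(* Z lies in the subgroup of degenerate cycles; this expresses [Z = 0] in Z^p(k,n)
   for a cycle Z in c^p(k,n). *)
Definition in_d {n} (Z : cubical_cycle k n) : Prop :=
  forall P, P \in dom Z -> degenerate P.

Definition face_restriction {n} (i : 'I_n) (b : bool) : mpoly n k -> mpoly n.-1 k :=
  mmap (@mpolyC n.-1 k)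
       (fun j => if unlift i j is Some j' then tvar j' else b%:R).

(* As t_i - b is a nonzerodivisor modulo P, Serre's intersection multiplicity is the
   length of the local ring of the scheme-theoretic intersection. *)
Definition prime_face {n} (i : 'I_n) (b : bool) (P : set (mpoly n k))
    : cubical_cycle k n.-1 :=
  let J : set (mpoly n.-1 k) := [set face_restriction i b q | q in P] in
  \sum_(W \in [set W | minimal_prime J W])
     (Freeg [:: (1%:Z, W)] : cubical_cycle k n.-1) *+ local_length J W.

(* Z . {z_i = 0} for b = false, Z . {z_i = oo} for b = true. *)
Definition face {n} (i : 'I_n) (b : bool) (Z : cubical_cycle k n) : cubical_cycle k n.-1 :=
  \sum_(P <- dom Z) prime_face i b P *~ coeff P Z.

Definition cyc_boundary {n} (Z : cubical_cycle k n) : cubical_cycle k n.-1 :=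
  \sum_(i < n) (face i true Z - face i false Z) *~ (-1) ^+ i.+1.

Definition normalized {n} (Z : cubical_cycle k n) : Prop :=
  forall (i : 'I_n) (b : bool), (i.+1 < n)%N -> in_d (face i b Z).

Definition cyc_closed {n} (Z : cubical_cycle k n) : Prop := in_d (cyc_boundary Z).

End Cycles.

(** * Complex logarithm and polylogarithms *)

Section ComplexFunctions.
Context {R : realType}.

Definition climit {T : Type} (F : set_system T) (u : T -> R[i]) : R[i] :=
  lim ((fun x => complex.Re (u x)) @ F) +i* lim ((fun x => complex.Im (u x)) @ F).

Definition modulus (w : R[i]) : R := Num.sqrt (complex.Re w ^+ 2 + complex.Im w ^+ 2).

(* Principal argument, with values in (-pi, pi]. *)
Definition argument (w : R[i]) : R :=
  let a := acos (complex.Re w / modulus w) in if 0 <= complex.Im w then a else - a.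

Definition clog (w : R[i]) : R[i] := ln (modulus w) +i* argument w.

Definition twopii : R[i] := 0 +i* (2 * pi).

(* exp (2 pi i / l) *)
Definition zeta_root (l : nat) : R[i] := cos (2 * pi / l%:R) +i* sin (2 * pi / l%:R).

Definition Li (r : nat) (z : R[i]) : R[i] :=
  climit \oo (fun N : nat => \sum_(1 <= m < N.+1) z ^+ m / m%:R ^+ r).

(* Iterated Lebesgue integral over R^m, the points being sequences of length m. *)
Fixpoint iterated_int (m : nat) (F : seq R -> R) : R :=
  if m is m'.+1 then
    \int[lebesgue_measure]_x iterated_int m' (fun s => F (x :: s))
  else F [::].

Definition citerated_int (m : nat) (F : seq R -> R[i]) : R[i] :=
  iterated_int m (fun s => complex.Re (F s)) +i* iterated_int m (fun s => complex.Im (F s)).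

End ComplexFunctions.

(** * R-proper precycles and the regulator *)

Section Regulator.
Context {R : realType} {k : fieldExtType rat} (iota : {rmorphism k -> R[i]}).

(* The analytic space of complex points, in the t-coordinates. *)
Definition an {n} (P : set (mpoly n k)) : set 'rV[R[i]]_n :=
  [set t | forall q, P q -> mmap iota (t 0) q = 0].

Definition zcoord {n} (t : 'rV[R[i]]_n) (i : 'I_n) : R[i] := t 0 i / (t 0 i - 1).

(* On R[i], [w < 0] means that w is a negative real number. *)
Definition Tcut {n} (i : 'I_n) : set 'rV[R[i]]_n := [set t | zcoord t i < 0].

(* The dimension of a real semialgebraic set S is the largest d such that S contains a
   homeomorphic copy of an open d-cube, equivalently of R^d. *)
Definition contains_cell {n} (d : nat) (S : set 'rV[R[i]]_n) : Prop :=
  exists phi : 'rV[R]_d -> 'rV[R[i]]_n,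
    [/\ forall j, continuous (fun x => complex.Re (phi x 0 j)),
        forall j, continuous (fun x => complex.Im (phi x 0 j)),
        injective phi & forall x, S (phi x)].

(* The intersection of the analytic variety with any of the cuts T_{z_i}, i in A, and
   any face has real codimension >= #|A| + 2 codim F in it (with d = 0, it is empty
   when this exceeds its real dimension 2 (n - p)). *)
Definition R_proper_prime {n} (p : nat) (P : set (mpoly n k)) : Prop :=
  forall (A : {set 'I_n}) (F : 'I_n -> option bool) (d : nat),
    contains_cell d
      (an P `&` [set t | forall i, i \in A -> Tcut i t]
            `&` [set t | forall i (b : bool), F i = Some b -> t 0 i = b%:R]) ->
    (d + #|A| + 2 * face_codim F + 2 * p <= 2 * n)%N.

(* A condition on the class of Z modulo degenerate cycles, hence on the
   nondegenerate components only. *)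
Definition R_proper {n} (p : nat) (Z : cubical_cycle k n) : Prop :=
  forall P, P \in dom Z -> ~ degenerate P -> R_proper_prime p P.

(* Z represents a precycle in N^p_R(k,n). *)
Definition in_NR {n} (p : nat) (Z : cubical_cycle k n) : Prop :=
  [/\ in_c p Z, normalized Z & R_proper p Z].

(* dz_i / z_i evaluated at the tangent vector w at t. *)
Definition dlog {n} (t : 'rV[R[i]]_n) (i : 'I_n) (w : 'rV[R[i]]_n) : R[i] :=
  w 0 i / t 0 i - w 0 i / (t 0 i - 1).

(* The current of integration along T_{z_i}, oriented from -oo to 0 so that
   d[log z] = dz/z - 2 pi i delta_T, is the limit for eps -> 0+ of the 1-forms
   (2 eps)^-1 1_{|arg (- z_i)| < eps} d arg z_i, i.e. the average of the currents of
   integration along the rays of argument in (pi - eps, pi + eps).  The restriction to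
   a variety of a product of such currents is the limit of the products of these forms;
   this also gives the intersection multiplicity where the variety does not meet the
   cuts transversally. *)
Definition delta_eps {n} (eps : R) (t : 'rV[R[i]]_n) (i : 'I_n)
    (w : 'rV[R[i]]_n) : R[i] :=
  ((if `|argument (- zcoord t i)| < eps then (2 * eps)^-1 else 0)
     * complex.Im (dlog t i w))%:C.

(* R_n at the point t in the variables listed in s, as a sum of terms [c, alphas]
   standing for c times the wedge product, in this order, of the 1-forms alphas. *)
Fixpoint Rcurrent {n} (eps : R) (t : 'rV[R[i]]_n) (s : seq 'I_n) :
    seq (R[i] * seq ('rV[R[i]]_n -> R[i])) :=
  if s is i :: s' then
    (clog (zcoord t i), map (dlog t) s') ::
    [seq (- (-1) ^+ size s * twopii * c.1, rcons c.2 (delta_eps eps t i))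
       | c <- Rcurrent eps t s']
  else [::].

Definition wedge_eval {n} m (alphas : seq ('rV[R[i]]_n -> R[i])) (u : 'I_m -> 'rV[R[i]]_n)
    : R[i] :=
  \det (\matrix_(a < m, b < m) nth (fun _ => 0) alphas a (u b)).

Definition tangent {n} (P : set (mpoly n k)) (t w : 'rV[R[i]]_n) : Prop :=
  forall q, P q -> \sum_(j < n) mmap iota (t 0) (mderiv j q) * w 0 j = 0.

(* The coordinates t_{I c}, c < d, are algebraically independent on the variety; when d
   is its dimension, projecting to them is generically finite and etale. *)
Definition alg_independent {n d} (P : set (mpoly n k)) (I : 'I_d -> 'I_n) : Prop :=
  forall q : mpoly d k, P (mmap (@mpolyC n k) (fun c => tvar (I c)) q) -> q = 0.

(* The tangent vector at t lifting the c-th basis vector of C^d. *)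
Definition tangent_lift {n d} (P : set (mpoly n k)) (I : 'I_d -> 'I_n)
    (t : 'rV[R[i]]_n) (c : nat) : 'rV[R[i]]_n :=
  xget 0 [set w | tangent P t w /\ forall c', w 0 (I c') = (val c' == c)%:R].

(* The real frame e_1, i e_1, e_2, i e_2, ... giving the complex orientation. *)
Definition frame {n d} (P : set (mpoly n k)) (I : 'I_d -> 'I_n) (t : 'rV[R[i]]_n)
    (b : 'I_d.*2) : 'rV[R[i]]_n :=
  (if odd b then 'i else 1) *: tangent_lift P I t b./2.

Definition Rvalue {n d} (eps : R) (P : set (mpoly n k)) (I : 'I_d -> 'I_n)
    (t : 'rV[R[i]]_n) : R[i] :=
  \sum_(c <- Rcurrent eps t (enum 'I_n)) c.1 * wedge_eval c.2 (frame P I t).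

Definition cpoint (x : seq R) (c : nat) : R[i] := x`_(c.*2) +i* x`_(c.*2.+1).

(* Integral of the regularized form over the variety of P, of dimension d, as the
   integral over C^d of its push-forward under a generically finite coordinate
   projection. *)
Definition int_prime_eps {n} (d : nat) (eps : R) (P : set (mpoly n k)) : R[i] :=
  xget 0 [set v | exists I : 'I_d -> 'I_n, alg_independent P I /\
    v = citerated_int d.*2 (fun x =>
          \sum_(t \in an P `&` [set t | forall c, t 0 (I c) = cpoint x c])
             Rvalue eps P I t)].

Definition int_prime {n} (d : nat) (P : set (mpoly n k)) : R[i] :=
  climit 0^'+ (fun eps : R => int_prime_eps d eps P).

(* Degenerate components are zero in Z^p(k,n). *)
Definition int_cycle {n} (d : nat) (Z : cubical_cycle k n) : R[i] :=
  \sum_(P <- dom Z | ~~ `[< degenerate P >]) (coeff P Z)%:~R * int_prime d P.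

(* A representative of the class of the regulator in C / (2 pi i)^r Z. *)
Definition regulator (r : nat) (Z : cubical_cycle k (2 * r - 1)) : R[i] :=
  int_cycle (r - 1) Z / twopii ^+ (r - 1).

End Regulator.

Section Torsion.
Context {R : realType}.

Definition eq_mod_periods (r : nat) (x y : R[i]) : Prop :=
  exists N : int, x - y = N%:~R * twopii ^+ r.

(* The class of x in C / (2 pi i)^r Z is torsion of order N. *)
Definition torsion_of_order (r : nat) (x : R[i]) (N : nat) : Prop :=
  (0 < N)%N /\ forall m : nat, eq_mod_periods r (x *+ m) 0 <-> (N %| m)%N.

End Torsion.

(** * Bernoulli polynomials *)

(* B_0, ..., B_(m-1), from \sum_(j <= m) 'C(m + 1, j) B_j = (m == 0). *)
Fixpoint bernoulli_numbers (m : nat) : seq rat :=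
  if m is m'.+1 then
    let s := bernoulli_numbers m' in
    rcons s (((m' == 0)%:R - \sum_(j < m') 'C(m'.+1, j)%:R * s`_j) / m'.+1%:R)
  else [::].

Definition bernoulli_poly (m : nat) : {poly rat} :=
  \sum_(j < m.+1) ('C(m, j)%:R * (bernoulli_numbers m.+1)`_j) *: 'X^(m - j).

(* Main.v *)
Require Import Defs.
From mathcomp Require Import all_boot all_order all_algebra all_field.
From mathcomp Require Import complex.
From mathcomp Require Import -(notations) freeg mpoly.
From mathcomp Require Import all_classical all_reals all_analysis.
From mathcomp Require Import ring lra.

(** The regulator is additive in the cycle, so modulo [twopii ^+ r] times integers
    the regulator of Z is [(r-1)! l^(r-1) \sum_a f(a) Li_r(zeta^a)], and everything
    reduces to evaluating this sum of polylogarithms.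

    The parity of f is what makes the sum elementary.  Split [Li_r(e^(2 pi i x))]
    into its cosine and sine series.  One of them has the parity of r under
    [x -> 1 - x]; it is a multiple of B_r(x) on [0, 1] ([bernoulli_fourier]).
    The other one has the opposite parity, so that it cancels against f in the sum
    over Z/lZ ([sum_opposite_parity]).  The result ([sum_polylog]) is
    [- (2 pi i)^r / (2 r!) \sum_a f(a) B_r(a/l)].  For r = 1 the series diverges
    at x = 0, but there f(0) = 0 because f is odd.
    Hence the regulator is [(M - tau) (2 pi i)^r] with M an integer, and its order
    in C / (2 pi i)^r Z is the least m with [m tau] an integer, i.e. the
    denominator of tau.

    The Fourier expansion is proved without integration.  Let [defect r N] be the
    N-th partial sum minus its expected limit; then
    [(defect r.+1 N)' = 2 pi (defect r N)], and [defect 0 N] is half the Dirichlet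
    kernel.
    - r = 1: adding [cos((2N+1) pi x) / ((2N+1) sin(pi x))] to [defect 1 N] yields a
      function vanishing at 1/2 whose derivative is O(1/N) away from 0 and 1, so
      [defect 1 N] is O(1/N) there ([defect1_decay]).
    - Every [defect r.+1 N] has a zero in [0, 1]: by Rolle, because its
      antiderivative [defect r.+2 N] takes the same value at 0 and 1
      ([defect_has_zero]).  This fixes the constants of integration.
    - r = 2: the oscillation of [defect 2 N] on [0, 1] tends to 0, by the case r = 1
      away from the ends and by the bound 1/M on the tails of the series near them;
      with the zero, [defect 2 N] tends to 0 uniformly ([defect2_uniform]).
    - r > 2: the mean value theorem from the zero bounds [defect r N] by 2 pi times the
      maximum of [defect r.-1 N] ([defect_uniform]). *)

Import Order.TTheory GRing.Theory Num.Theory.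
Import numFieldNormedType.Exports.

Set Implicit Arguments.
Unset Strict Implicit.
Unset Printing Implicit Defensive.

Local Open Scope classical_set_scope.
Local Open Scope ring_scope.
Local Open Scope complex_scope.

(** * Bernoulli numbers and polynomials *)

Section Bernoulli.

Definition bernoulli (j : nat) : rat := (bernoulli_numbers j.+1)`_j.

Lemma size_bernoulli_numbers m : size (bernoulli_numbers m) = m.
Proof. by elim: m => //= m IH; rewrite size_rcons IH. Qed.

Lemma nth_bernoulli_numbers m j :
  (j < m)%N -> (bernoulli_numbers m)`_j = bernoulli j.
Proof.
elim: m => // m IH; rewrite ltnS leq_eqVlt => /predU1P[-> //|jm].
by rewrite /= nth_rcons size_bernoulli_numbers jm IH.
Qed.

(** The last entry of the list is defined by solving this relation for it. *)
Lemma bernoulli_rec m :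
  \sum_(j < m.+1) 'C(m.+1, j)%:R * bernoulli j = (m == 0%N)%:R.
Proof.
rewrite big_ord_recr /= {2}/bernoulli /= nth_rcons size_bernoulli_numbers ltnn eqxx.
rewrite -[X in 'C(X, m)]add1n binSn.
under [X in _ - X]eq_bigr => j _ do rewrite nth_bernoulli_numbers //.
rewrite mulrC divfK ?pnatr_eq0 // addrC subrK //.
Qed.

Lemma bernoulli0 : bernoulli 0 = 1.
Proof. by have := bernoulli_rec 0; rewrite big_ord1 bin0 mul1r. Qed.

Lemma bernoulli1 : bernoulli 1 = - 2^-1.
Proof.
have := bernoulli_rec 1; rewrite !big_ord_recr big_ord0 /= bernoulli0 bin0 binS.
by rewrite bin0 bin1 => h; lra.
Qed.

Lemma bernoulli_polyE m :
  bernoulli_poly m = \sum_(j < m.+1) ('C(m, j)%:R * bernoulli j) *: 'X^(m - j).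
Proof. by apply: eq_bigr => j _; rewrite nth_bernoulli_numbers. Qed.

Lemma deriv_bernoulli_poly m :
  (bernoulli_poly m.+1)^`() = m.+1%:R *: bernoulli_poly m.
Proof.
rewrite !bernoulli_polyE big_ord_recr /= subnn expr0 derivD derivZ.
rewrite -[X in _ *: X^`()]/(1%:P) derivC scaler0 addr0 raddf_sum scaler_sumr /=.
apply: eq_bigr => j _; have jm : (j <= m)%N by rewrite -ltnS.
rewrite derivZ derivXn subSn //= -scaler_nat !scalerA; congr (_ *: _).
rewrite mulrAC mulrA -!natrM; congr (_%:R * _).
by rewrite mulnC -subSn // -mul_bin_down.
Qed.

(** The two values differ by the sum of ['C(m.+2, j) * bernoulli j] over
    [j < m.+2], which vanishes by the recursion. *)
Lemma bernoulli_poly_ends m : (bernoulli_poly m.+2).[1] = (bernoulli_poly m.+2).[0].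
Proof.
rewrite !bernoulli_polyE !horner_sum !(big_ord_recr m.+2) /= subnn !hornerE.
congr (_ + _).
under eq_bigr => j _ do rewrite !hornerE expr1n mulr1.
rewrite bernoulli_rec big1 // => j _.
by rewrite !hornerE expr0n subn_eq0 leqNgt ltn_ord mulr0.
Qed.

End Bernoulli.

(** * Fourier series of the Bernoulli polynomials *)

Section Fourier.
Context {R : realType}.
Implicit Types (x y : R).

(** All estimates below are instances of this form of the mean value theorem. *)
Lemma le_mean_value (f df : R -> R) (a b C : R) :
  (forall t, a <= t <= b -> is_derive t 1 f (df t)) ->
  (forall t, a <= t <= b -> `|df t| <= C) ->
  forall x y, a <= x <= b -> a <= y <= b -> `|f x - f y| <= C * `|x - y|.
Proof.
move=> df_f dfC.
have main x y : a <= x -> x <= y -> y <= b -> `|f y - f x| <= C * `|y - x|.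
  move=> ax xy yb.
  have der t : t \in `]x, y[%R -> is_derive t 1 f (df t).
    rewrite in_itv /= => /andP[xt ty]; apply: df_f.
    by rewrite (le_trans ax (ltW xt)) (le_trans (ltW ty) yb).
  have [|c] := MVT_segment xy der.
  - apply: derivable_within_continuous => t; rewrite in_itv /= => /andP[xt ty].
    by have /df_f[] : a <= t <= b by rewrite (le_trans ax xt) (le_trans ty yb).
  - rewrite in_itv /= => /andP[xt ty] ->; rewrite normrM ler_wpM2r // dfC //.
    by rewrite (le_trans ax xt) (le_trans ty yb).
move=> x y /andP[ax xb] /andP[ay yb].
case/orP: (le_total x y) => xy; last exact: main.
by rewrite distrC (distrC x); apply: main.
Qed.

(** This is [cos (y - r pi / 2)]: the shift makes differentiation lower r with no
    sign, and puts the Fourier series of all the B_r in one form. *)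
Fixpoint shifted_cos (r : nat) : R -> R :=
  match r with
  | 0 => cos
  | 1 => sin
  | r'.+2 => fun y => - shifted_cos r' y
  end.

Lemma is_derive_shifted_cos r y :
  is_derive y 1 (shifted_cos r.+1) (shifted_cos r y).
Proof.
suff: is_derive y 1 (shifted_cos r.+1) (shifted_cos r y) /\
  is_derive y 1 (shifted_cos r.+2) (shifted_cos r.+1 y) by case.
elim: r => [|r [IH1 IH2]] /=; split => //.
- exact: is_derive_sin.
- by apply: is_derive_eq; rewrite opprK.
- exact: is_deriveN.
Qed.

Lemma norm_shifted_cos r y : `|shifted_cos r y| <= 1.
Proof.
suff: `|shifted_cos r y| <= 1 /\ `|shifted_cos r.+1 y| <= 1 by case.
elim: r => [|r [IH1 IH2]] /=; last by rewrite normrN.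
by rewrite !ler_norml !cos_geN1 !cos_le1 !sin_geN1 !sin_le1.
Qed.

Lemma is_derive_shifted_cos_scale r (c x : R) :
  is_derive x 1 (fun x => shifted_cos r.+1 (c * x)) (shifted_cos r (c * x) * c).
Proof.
apply: (@is_derive1_comp R (shifted_cos r.+1) ( *%R c) x).
  exact: is_derive_shifted_cos.
have : is_derive x 1 (c \*: @idfun R^o) (c *: 1) by exact: is_deriveZ.
by rewrite /GRing.scale /= mulr1.
Qed.

Definition trig_sum (r N : nat) (x : R) : R :=
  \sum_(1 <= m < N.+1) shifted_cos r (2 * pi * m%:R * x) / m%:R ^+ r.

Definition real_bernoulli_poly (r : nat) : {poly R} :=
  map_poly ratr (bernoulli_poly r).

(** Partial sum of the Fourier series minus its expected limit. *)
Definition defect (r N : nat) (x : R) : R :=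
  trig_sum r N x + (2 * pi) ^+ r / (2 * r`!%:R) * (real_bernoulli_poly r).[x].

Lemma is_derive_sum_nat (m n : nat) (f df : nat -> R -> R) x :
  (forall i, is_derive x 1 (f i) (df i x)) ->
  is_derive x 1 (fun y => \sum_(m <= i < n) f i y) (\sum_(m <= i < n) df i x).
Proof.
move=> dfi; elim: n => [|n IH].
  rewrite big_geq //; under eq_fun do rewrite big_geq //.
  exact: is_derive_cst.
have [mn|nm] := leqP m n; last first.
  rewrite big_geq //; under eq_fun do rewrite big_geq //.
  exact: is_derive_cst.
rewrite big_nat_recr //=; under eq_fun do rewrite big_nat_recr //=.
exact: is_deriveD.
Qed.

Lemma is_derive_trig_sum r N x :
  is_derive x 1 (trig_sum r.+1 N) (2 * pi * trig_sum r N x).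
Proof.
rewrite /trig_sum mulr_sumr big_add1 /=.
under eq_fun do rewrite big_add1 /=.
pose df m y := 2 * pi * (shifted_cos r (2 * pi * m.+1%:R * y) / m.+1%:R ^+ r) : R.
apply: (@is_derive_sum_nat 0 N (fun m y => _) df) => m.
apply: is_derive_eq.
  under eq_fun do rewrite mulrC.
  apply: is_deriveZ; exact: is_derive_shifted_cos_scale.
have m0 : m.+1%:R != 0 :> R by rewrite pnatr_eq0.
rewrite /df /GRing.scale /= exprS; move: (m.+1%:R : R) m0 => a a0.
by field; rewrite a0 expf_neq0.
Qed.

Lemma is_derive_mull (c : R) (f : R -> R) df x :
  is_derive x 1 f df -> is_derive x 1 (fun y => c * f y) (c * df).
Proof. exact: is_deriveZ. Qed.

Lemma deriv_real_bernoulli_poly r :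
  (real_bernoulli_poly r.+1)^`() = r.+1%:R *: real_bernoulli_poly r.
Proof.
by rewrite /real_bernoulli_poly deriv_map deriv_bernoulli_poly map_polyZ /= ratr_nat.
Qed.

Lemma is_derive_defect r N x :
  is_derive x 1 (defect r.+1 N) (2 * pi * defect r N x).
Proof.
apply: is_derive_eq.
  apply: is_deriveD; first exact: is_derive_trig_sum.
rewrite deriv_real_bernoulli_poly hornerZ /defect [RHS]mulrDr; congr (_ + _).
rewrite /GRing.scale /= factS natrM exprS.
have r0 : r`!%:R != 0 :> R by rewrite pnatr_eq0 -lt0n fact_gt0.
by field; rewrite r0 /= nat1r pnatr_eq0.
Qed.

Lemma shifted_cos_periodic r y k :
  shifted_cos r (y + 2 * pi * k%:R) = shifted_cos r y.
Proof.
have -> : 2 * pi * k%:R = (pi *+ 2) *+ k :> R by rewrite mulr_natr mulr2n mulrDl mul1r mulr2n.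
suff: shifted_cos r (y + (pi *+ 2) *+ k) = shifted_cos r y /\
  shifted_cos r.+1 (y + (pi *+ 2) *+ k) = shifted_cos r.+1 y by case.
elim: r => [|r [IH1 IH2]] /=; last by rewrite IH1.
split; [exact/periodicn/cosD2pi|exact/periodicn/sinD2pi].
Qed.

Lemma defect_ends r N : defect r.+2 N 1 = defect r.+2 N 0.
Proof.
rewrite /defect /real_bernoulli_poly.
congr (_ + _ * _); last first.
  rewrite -[X in _.[X]](rmorph1 ratr) -[X in _ = _.[X]](rmorph0 ratr) !horner_map.
  by rewrite bernoulli_poly_ends.
apply: eq_bigr => m _; congr (_ / _).
by rewrite mulr0 mulr1 -[X in _ X = _]add0r shifted_cos_periodic.
Qed.

(** Rolle applied to the next defect, of which this one is the derivative up to the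
    factor [2 * pi].  It replaces the computation of the mean value. *)
Lemma defect_has_zero r N : exists2 x, 0 <= x <= 1 & defect r.+1 N x = 0.
Proof.
have [||||x] := @Rolle R (defect r.+2 N) 0 1.
- exact: ltr01.
- by move=> x _; have [] := is_derive_defect r.+1 N x.
- apply: derivable_within_continuous => x _.
  by have [] := is_derive_defect r.+1 N x.
- by rewrite defect_ends.
rewrite in_itv /= => /andP[x0 x1] dx; exists x; first by rewrite !ltW.
have [_ d1] := is_derive_defect r.+1 N x; have [_ d0] := dx.
move: d1; rewrite d0 => /esym/eqP; rewrite mulf_eq0 => /orP[|/eqP//].
by rewrite mulf_eq0 pnatr_eq0 /= gt_eqF // pi_gt0.
Qed.

Lemma real_bernoulli_poly0 x : (real_bernoulli_poly 0).[x] = 1.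
Proof.
rewrite /real_bernoulli_poly bernoulli_polyE big_ord1 bernoulli0 bin0 mulr1 scale1r.
by rewrite expr0 rmorph1 hornerE.
Qed.

Lemma real_bernoulli_poly1 x : (real_bernoulli_poly 1).[x] = x - 2^-1.
Proof.
rewrite /real_bernoulli_poly bernoulli_polyE big_ord_recr big_ord1 /=.
rewrite bernoulli0 bernoulli1 bin0 binn !mul1r scale1r expr1 expr0 rmorphD /=.
by rewrite map_polyZ map_polyX rmorph1 !hornerE rmorphN fmorphV rmorph_nat.
Qed.

(** Closed form of the Dirichlet kernel, whose half is [defect 0 N]. *)
Lemma sin_mul_defect0 N x :
  2 * sin (pi * x) * defect 0 N x = sin ((2 * N + 1)%:R * pi * x) :> R.
Proof.
rewrite /defect real_bernoulli_poly0 /trig_sum; elim: N => [|N IH].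
  by rewrite big_geq // add0r muln0 add0n mul1r (mul1r pi) fact0; field.
rewrite big_nat_recr //= expr0 divr1.
rewrite [_ + cos _]addrC -addrA mulrDr {}IH.
have -> : (2 * N.+1 + 1)%:R * pi * x = 2 * pi * N.+1%:R * x + pi * x.
  by rewrite natrD natrM -!(natr1 N); ring.
have -> : (2 * N + 1)%:R * pi * x = 2 * pi * N.+1%:R * x - pi * x.
  by rewrite natrD natrM -!(natr1 N); ring.
by rewrite sinB sinD; ring.
Qed.

Lemma sin_bounded_below (d : R) : 0 < d <= 2^-1 ->
  exists2 s : R, 0 < s & forall x, d <= x <= 1 - d -> s <= sin (pi * x).
Proof.
move=> /andP[d0 d2].
have [||c] := @EVT_min R (fun x => sin (pi * x)) d (1 - d).
- lra.
- apply: derivable_within_continuous => x _.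
  by have [] := is_derive_shifted_cos_scale 0 (pi : R) x.
rewrite in_itv /= => /andP[dc c1] cmin.
exists (sin (pi * c)) => [|x dx]; last by apply: cmin; rewrite in_itv.
have p0 := pi_gt0 R; apply: sin_gt0_pi; apply/andP; split; nra.
Qed.

(** The added term is what one integration by parts of the Dirichlet kernel
    produces: its derivative cancels the oscillating kernel and leaves a remainder
    with the factor [1 / (2 N + 1)]. *)
Definition corrected_defect1 (N : nat) (x : R) : R :=
  defect 1 N x + (2 * N + 1)%:R^-1 * (cos ((2 * N + 1)%:R * pi * x) / sin (pi * x)).

Lemma is_derive_corrected_defect1 N x : sin (pi * x) != 0 ->
  is_derive x 1 (corrected_defect1 N)
    (- ((2 * N + 1)%:R^-1 *
        (pi * cos ((2 * N + 1)%:R * pi * x) * cos (pi * x) / sin (pi * x) ^+ 2))).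
Proof.
move=> s0.
have dcos : is_derive x 1 (fun y => cos ((2 * N + 1)%:R * pi * y) : R)
    (- sin ((2 * N + 1)%:R * pi * x) * ((2 * N + 1)%:R * pi)).
  have := is_deriveN (is_derive_shifted_cos_scale 1 ((2 * N + 1)%:R * pi) x).
  rewrite /= mulNr; congr is_derive; apply/funext => y /=; exact: opprK.
have dsin := is_derive_shifted_cos_scale 0 (pi : R) x.
have dinv := is_deriveV s0 dsin.
have := is_deriveD (is_derive_defect 0 N x)
  (is_derive_mull (2 * N + 1)%:R^-1 (is_deriveM dcos dinv)).
move=> der; apply: (is_derive_eq der).
have N0 : (2 * N + 1)%:R != 0 :> R by rewrite pnatr_eq0 addn1.
have -> : defect 0 N x = sin ((2 * N + 1)%:R * pi * x) / (2 * sin (pi * x)).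
  by rewrite -sin_mul_defect0; field.
rewrite /GRing.scale /=; move: ((2 * N + 1)%:R : R) N0 => a a0.
by field; rewrite s0 a0.
Qed.

Lemma defect1_half N : defect 1 N (2^-1 : R) = 0.
Proof.
rewrite /defect real_bernoulli_poly1 subrr mulr0 addr0 /trig_sum big1_seq // => m _.
have -> : 2 * pi * m%:R * 2^-1 = 0 + pi *+ m :> R by rewrite -mulr_natr; field.
rewrite [shifted_cos _ _](_ : _ = 0) ?mul0r //=.
elim: m => [|m IH]; first by rewrite addr0 sin0.
by rewrite mulrSr addrA sinDpi IH oppr0.
Qed.

Lemma corrected_defect1_half N : corrected_defect1 N (2^-1 : R) = 0.
Proof.
rewrite /corrected_defect1 defect1_half add0r.
rewrite [cos _](_ : _ = 0) ?mul0r ?mulr0 //.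
rewrite [_ * _ / _](_ : _ = 0 + pi *+ N + pi / 2); last first.
  by rewrite natrD natrM -mulr_natr; field.
rewrite cosDpihalf; apply/eqP; rewrite oppr_eq0; apply/eqP.
elim: N => [|m IH]; first by rewrite addr0 sin0.
by rewrite mulrSr addrA sinDpi IH oppr0.
Qed.

(** The corrected defect vanishes at 1/2 and has small derivative on [d, 1 - d], and
    the correction itself is small there.  The constant K blows up as d tends to 0,
    as it must since the sawtooth jumps at the integers. *)
Lemma defect1_decay (d : R) : 0 < d <= 2^-1 ->
  exists K : R, forall N x, d <= x <= 1 - d -> `|defect 1 N x| <= K / (2 * N + 1)%:R.
Proof.
move=> dd; have [s s0 sle] := sin_bounded_below dd.
have p0 := pi_gt0 R.
exists (pi / s ^+ 2 + s^-1) => N x dx.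
set a : R := (2 * N + 1)%:R; have a0 : 0 < a by rewrite /a ltr0n addn1.
have cos1 y : `|cos y| <= 1 :> R by rewrite ler_norml cos_geN1 cos_le1.
have sinV t : d <= t <= 1 - d -> `|(sin (pi * t))^-1| <= s^-1.
  move=> dt; have st := sle t dt.
  by rewrite normfV lef_pV2 ?posrE ?normr_gt0 ?gt_eqF ?(lt_le_trans s0) // (le_trans st) ?ler_norm.
have half : d <= 2^-1 <= 1 - d by lra.
have der t (dt : d <= t <= 1 - d) := is_derive_corrected_defect1 N
  (lt0r_neq0 (lt_le_trans s0 (sle t dt))).
have bound t : d <= t <= 1 - d ->
    `|- (a^-1 * (pi * cos (a * pi * t) * cos (pi * t) / sin (pi * t) ^+ 2))|
    <= a^-1 * (pi / s ^+ 2).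
  move=> dt; rewrite normrN -!exprVn.
  have : `|(sin (pi * t))^-1 ^+ 2| <= s^-1 ^+ 2.
    by rewrite normrX lerXn2r ?nnegrE ?invr_ge0 ?(ltW s0) // sinV.
  move: (_ ^+ 2) (_ ^+ 2) => u v uv.
  rewrite !normrM (ger0_norm (ltW p0)) ger0_norm ?invr_ge0 ?(ltW a0) //.
  rewrite ler_wpM2l ?invr_ge0 ?(ltW a0) // -!mulrA ler_wpM2l ?(ltW p0) //.
  by rewrite mulrA -[leRHS]mul1r ler_pM ?mulr_ge0 // -[1]mulr1 ler_pM.
have := le_mean_value der bound dx half.
rewrite corrected_defect1_half subr0 /corrected_defect1 -/a => h.
have c_small : `|a^-1 * (cos (a * pi * x) / sin (pi * x))| <= a^-1 * s^-1.
  rewrite normrM ger0_norm ?invr_ge0 ?(ltW a0) // ler_pM2l ?invr_gt0 //.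
  by rewrite normrM -[leRHS]mul1r ler_pM // sinV.
have xh : `|x - 2^-1| <= 1 by rewrite ler_norml; lra.
have p1 : 0 <= a^-1 * (pi / s ^+ 2).
  by rewrite mulr_ge0 ?divr_ge0 ?invr_ge0 ?exprn_ge0 ?ltW.
have h1 : a^-1 * (pi / s ^+ 2) * `|x - 2^-1| <= a^-1 * (pi / s ^+ 2).
  by rewrite -[leRHS]mulr1 ler_wpM2l.
rewrite mulrDl mulrC [s^-1 * _]mulrC.
set c := a^-1 * (cos _ / _) in h c_small.
have -> : defect 1 N x = (defect 1 N x + c) - c by rewrite addrK.
by apply: (le_trans (ler_normB _ _)); apply: lerD; first exact: le_trans h1.
Qed.

(** Telescoping: [1 / (N + 1) ^ 2 <= 1 / N - 1 / (N + 1)]. *)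
Lemma trig_sum2_tail M N x : (0 < M <= N)%N ->
  `|trig_sum 2 N x - trig_sum 2 M x| <= M%:R^-1 - N%:R^-1.
Proof.
case/andP=> M0; elim: N => [|N IH]; first by case: M M0.
rewrite leq_eqVlt => /predU1P[<-|]; first by rewrite !subrr normr0.
rewrite ltnS => MN; have {IH} := IH MN.
rewrite /trig_sum (big_nat_recr N.+1) //=.
set S := (\sum_(1 <= i < N.+1) _); set S' := (\sum_(1 <= i < M.+1) _).
set c := - cos _; move=> IH.
have N0 : 0 < N%:R :> R by rewrite ltr0n (leq_trans M0).
have c1 : `|c| <= 1 by rewrite normrN ler_norml cos_geN1 cos_le1.
have step : `|c / N.+1%:R ^+ 2| <= N%:R^-1 - N.+1%:R^-1.
  rewrite -[N.+1%:R]natr1; move: (N%:R : R) N0 => a a0.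
  have -> : a^-1 - (a + 1)^-1 = (a * (a + 1))^-1.
    by field; rewrite !gt_eqF ?addr_gt0.
  rewrite normrM normfV -[leRHS]mul1r ler_pM ?invr_ge0 //.
  rewrite ger0_norm ?exprn_ge0 ?addr_ge0 ?(ltW a0) // lef_pV2 ?posrE ?exprn_gt0 ?mulr_gt0 ?addr_gt0 //.
  nra.
have -> : S + c / N.+1%:R ^+ 2 - S' = (S - S') + c / N.+1%:R ^+ 2 by ring.
apply: (le_trans (ler_normD _ _)); apply: (le_trans (lerD IH step)).
by rewrite addrA subrK.
Qed.

Lemma defect2_tail M N x : (0 < M <= N)%N ->
  `|defect 2 N x - defect 2 M x| <= M%:R^-1.
Proof.
move=> MN; rewrite /defect opprD addrACA subrr addr0.
apply: le_trans (trig_sum2_tail x MN) _.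
by rewrite lerBlDr lerDl invr_ge0.
Qed.

(** A crude Lipschitz bound for [defect 2 M]: M stays fixed while N grows. *)
Lemma norm_defect1_le M x : 0 <= x <= 1 -> `|defect 1 M x| <= M%:R + 4.
Proof.
move=> x01; rewrite /defect real_bernoulli_poly1.
apply: (le_trans (ler_normD _ _)); apply: lerD.
  rewrite /trig_sum; elim: M => [|M IH]; first by rewrite big_geq // normr0.
  rewrite big_nat_recr //= -[leRHS]natr1; apply: (le_trans (ler_normD _ _)).
  apply: lerD => //; rewrite normrM normfV expr1 (ger0_norm (ler0n _ _)).
  rewrite ler_pdivrMr // mul1r.
  have /le_trans-> // : `|sin (2 * pi * M.+1%:R * x)| <= 1 :> R.
    by rewrite ler_norml sin_geN1 sin_le1.
  by rewrite ler1n.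
have pi4 : pi < 4 :> R by have := pihalf_lt2 R; lra.
have p0 := pi_gt0 R.
rewrite expr1 (_ : 1`! = 1%N) // mulr1 [2 * pi]mulrC mulfK ?pnatr_eq0 //.
by rewrite ler_norml; apply/andP; split; nra.
Qed.

(** Within distance d every point of [0, 1] can be moved into the region where
    [defect1_decay] applies. *)
Lemma nearest_point_in_core (d x : R) : 0 <= d <= 2^-1 -> 0 <= x <= 1 ->
  exists2 x', d <= x' <= 1 - d & `|x - x'| <= d.
Proof.
move=> dd x01; have [xd|dx] := leP x d; first by exists d; rewrite ?ler_norml; lra.
have [xd|dx'] := leP (1 - d) x; first by exists (1 - d); rewrite ?ler_norml; lra.
by exists x; rewrite ?subrr ?normr0; lra.
Qed.

(** The oscillation of [defect 2 N] over [0, 1] is O(1/M) for a fixed M and all large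
    N: inside [d, 1 - d] its derivative is small, and near the ends it stays within
    1/M of [defect 2 M], which varies little over a length d = 1 / (M + 4)^2.  As it
    has a zero, it is small everywhere. *)
Lemma defect2_uniform (e : R) : 0 < e ->
  exists N0, forall N x, (N0 <= N)%N -> 0 <= x <= 1 -> `|defect 2 N x| <= e.
Proof.
move=> e0.
(* 28 = 10 + 8 + 10: two moves into the core, and one variation inside it. *)
have [M M0 Me] : exists2 M, (0 < M)%N & 28 * M%:R^-1 <= e.
  have [M hM] : exists M : nat, 28 / e < M%:R.
    by exists (Num.bound (28 / e)); apply: archi_boundP; rewrite divr_ge0 // ltW.
  have M0 : 0 < M%:R :> R by apply: le_lt_trans hM; rewrite divr_ge0 // ltW.
  exists M; first by rewrite -(ltr0n R).
  by rewrite ler_pdivrMr // mulrC -ler_pdivrMr // ltW.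
have m0 : 0 < M%:R :> R by rewrite ltr0n.
have m1 : 1 <= M%:R :> R by rewrite ler1n.
have p0 := pi_gt0 R.
have pi4 : pi < 4 :> R by have := pihalf_lt2 R; lra.
set m : R := M%:R in Me m0 m1.
pose d : R := ((m + 4) ^+ 2)^-1.
have d0 : 0 < d by rewrite invr_gt0 exprn_gt0 // addr_gt0.
have dm : d * (m + 4) ^+ 2 = 1 by rewrite mulVf // gt_eqF // exprn_gt0 // addr_gt0.
have d2 : d <= 2^-1 by nra.
have dd : 0 < d <= 2^-1 by rewrite d0.
have [K HK] := defect1_decay dd.
have [N1 hN1] : exists N1 : nat, K * m < N1%:R.
  by exists (Num.bound (`|K| * m)); apply: le_lt_trans (archi_boundP _);
     rewrite ?mulr_ge0 ?ler_wpM2r ?ler_norm ?(ltW m0).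
exists (maxn M N1) => N x; rewrite geq_max => /andP[MN N1N] x01.
set im := m^-1 in Me.
have im0 : 0 < im by rewrite invr_gt0.
have imm : im * m = 1 by rewrite mulVf ?gt_eqF.
(* Variation inside the core, from the decay of the case r = 1. *)
have core t : d <= t <= 1 - d -> `|2 * pi * defect 1 N t| <= 8 * im.
  move=> dt; rewrite normrM ger0_norm ?mulr_ge0 ?(ltW p0) //.
  have : `|defect 1 N t| <= im.
    apply: le_trans (HK N t dt) _; rewrite ler_pdivrMr ?ltr0n ?addn1 //.
    rewrite mulrC ler_pdivlMr //; apply: le_trans (ltW hN1) _.
    by rewrite ler_nat (leq_trans N1N) // mul2n -addnn -addnS leq_addr.
  have := normr_ge0 (defect 1 N t); nra.
(* Moving into the core: two tails of size 1/M and the variation of [defect 2 M]. *)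
have near t : 0 <= t <= 1 -> exists2 t', d <= t' <= 1 - d &
    `|defect 2 N t - defect 2 N t'| <= 10 * im.
  move=> t01; have [||t' dt' tt'] := @nearest_point_in_core d t; [lra|by []|].
  exists t' => //.
  have t'01 : 0 <= t' <= 1 by lra.
  have MN' : (0 < M <= N)%N by rewrite M0.
  have h1 := defect2_tail t MN'; have h2 := defect2_tail t' MN'.
  have h3 : `|defect 2 M t - defect 2 M t'| <= 8 * (m + 4) * `|t - t'|.
    apply: (@le_mean_value _ _ 0 1) => // [u _|u u01].
      exact: is_derive_defect.
    rewrite normrM ger0_norm ?mulr_ge0 ?(ltW p0) //.
    have := norm_defect1_le M u01; have := normr_ge0 (defect 1 M u); rewrite -/m; nra.
  have h4 : 8 * (m + 4) * `|t - t'| <= 8 * im.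
    have : (m + 4) * d <= im.
      rewrite /im -[leRHS]mul1r ler_pdivlMr // -[leRHS]dm.
      have : 0 <= d * (m + 4) by rewrite mulr_ge0 ?addr_ge0 // ltW.
      lra.
    nra.
  have -> : defect 2 N t - defect 2 N t' = (defect 2 N t - defect 2 M t)
     - (defect 2 N t' - defect 2 M t') + (defect 2 M t - defect 2 M t') by ring.
  apply: (le_trans (ler_normD _ _)).
  have := ler_normB (defect 2 N t - defect 2 M t) (defect 2 N t' - defect 2 M t').
  rewrite -/m -/im in h1 h2; lra.
have [y y01 zy] := @defect_has_zero 1 N.
have [x' dx' hx] := near x x01; have [y' dy' hy] := near y y01.
have hxy : `|defect 2 N x' - defect 2 N y'| <= 8 * im * `|x' - y'|.
  apply: (@le_mean_value _ _ d (1 - d)) core _ _ dx' dy' => u _.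
  exact: is_derive_defect.
have hxy1 : `|x' - y'| <= 1 by rewrite ler_norml; lra.
have -> : defect 2 N x = (defect 2 N x - defect 2 N x') + (defect 2 N x' - defect 2 N y')
  - (defect 2 N y - defect 2 N y') by rewrite zy; ring.
apply: (le_trans (ler_normB _ _)).
have := ler_normD (defect 2 N x - defect 2 N x') (defect 2 N x' - defect 2 N y').
nra.
Qed.

(** Starting at a zero, integrating over [0, 1] multiplies the maximum by at most
    [2 * pi < 8]. *)
Lemma defect_uniform r (e : R) : 0 < e ->
  exists N0, forall N x, (N0 <= N)%N -> 0 <= x <= 1 -> `|defect r.+2 N x| <= e.
Proof.
elim: r e => [|r IH] e e0; first exact: defect2_uniform.
have pi4 : pi < 4 :> R by have := pihalf_lt2 R; lra.
have p0 := pi_gt0 R.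
have [|N0 HN0] := IH (e / 8); first by rewrite divr_gt0.
exists N0 => N x N0N x01.
have [y y01 zy] := @defect_has_zero r.+2 N.
have : `|defect r.+3 N x - defect r.+3 N y| <= e * `|x - y|.
  apply: (@le_mean_value _ _ 0 1) => // [u _|u u01]; first exact: is_derive_defect.
  rewrite normrM ger0_norm ?mulr_ge0 ?(ltW p0) //.
  have := HN0 N u N0N u01; have := normr_ge0 (defect r.+2 N u); nra.
have : `|x - y| <= 1 by rewrite ler_norml; lra.
rewrite zy subr0; nra.
Qed.

Lemma bernoulli_fourier r x : (0 < r)%N -> 0 <= x <= 1 ->
    (r = 1%N -> 0 < x < 1) ->
  trig_sum r N x @[N --> \oo] -->
    - ((2 * pi) ^+ r / (2 * r`!%:R) * (real_bernoulli_poly r).[x]).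
Proof.
move=> r0 x01 hr1.
suff H : forall e, 0 < e -> exists N0, forall N, (N0 <= N)%N -> `|defect r N x| <= e.
  apply/cvgrPdist_le => e /H[N0 HN0]; near=> N.
  rewrite -opprD normrN addrC; apply: HN0; near: N; exact: nbhs_infty_ge.
case: r r0 hr1 => // -[|r] _ hr1 e e0; last first.
  by have [N0 HN0] := defect_uniform r e0; exists N0 => N ?; exact: HN0.
have /andP[x0 x1] := hr1 erefl.
(* Any d with 0 < d <= 1/2 and d <= x <= 1 - d will do. *)
pose d := x * (1 - x) / 2.
have dd : 0 < d <= 2^-1 by rewrite /d; apply/andP; split; nra.
have [K HK] := defect1_decay dd.
exists (Num.bound (`|K| / e)) => N hN.
apply: le_trans (HK N x _) _; first by rewrite /d; apply/andP; split; nra.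
rewrite ler_pdivrMr ?ltr0n ?addn1 // mulrC -ler_pdivrMr //.
apply: (@le_trans _ _ (`|K| / e)).
  by rewrite ler_pM2r ?invr_gt0 // ler_norm.
apply: le_trans (ltW (archi_boundP _)) _; first by rewrite divr_ge0 // ltW.
by rewrite ler_nat (leq_trans hN) // mul2n -addnn -addnS leq_addr.
Unshelve. all: by end_near.
Qed.
End Fourier.

(** * Additivity of the regulator *)

Section Regulator.

(** Summing over a fixed list of primes containing all supports makes a sum over the
    support linear in the cycle. *)
Lemma sum_dom_widen (T : choiceType) (C : nzRingType) (P : pred T) (g : T -> C)
    (D : FreegDefs.type_of (Phant int) (Phant T)) (s : seq T) :
  uniq s -> {subset dom D <= s} ->
  \sum_(x <- dom D | P x) (coeff x D)%:~R * g x =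
  \sum_(x <- s | P x) (coeff x D)%:~R * g x.
Proof.
move=> us sub; rewrite [RHS](bigID (mem (dom D))) /= [X in _ + X]big1 ?addr0; last first.
  by move=> x /andP[_ /coeff_outdom ->]; rewrite mul0r.
under [RHS]eq_bigl => x do rewrite andbC.
rewrite -big_filter_cond; apply: perm_big; apply: uniq_perm.
- exact: uniq_dom.
- exact: filter_uniq.
- by move=> x; rewrite mem_filter andb_idr //; exact: sub.
Qed.

Lemma regulator_lincomb (R : realType) (k : fieldExtType rat)
    (iota : {rmorphism k -> R[i]}) (r : nat) (I : finType)
    (D : I -> cubical_cycle k (2 * r - 1)) (c : I -> int) :
  regulator iota (\sum_i D i *~ c i) = \sum_i (c i)%:~R * regulator iota (D i).
Proof.
rewrite /regulator; under [RHS]eq_bigr => i _ do rewrite mulrA.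
rewrite -mulr_suml; congr (_ / _); rewrite /int_cycle.
set E := \sum_i _.
set s := undup (dom E ++ flatten [seq dom (D i) | i <- enum I]).
have us : uniq s by exact: undup_uniq.
have subE : {subset dom E <= s} by move=> x xE; rewrite mem_undup mem_cat xE.
have subD i : {subset dom (D i) <= s}.
  move=> x xD; rewrite mem_undup mem_cat; apply/orP; right.
  by apply/flatten_mapP; exists i => //; rewrite mem_enum.
rewrite (sum_dom_widen _ _ us subE).
under [RHS]eq_bigr => i _ do rewrite (sum_dom_widen _ _ us (@subD i)) mulr_sumr.
rewrite exchange_big /=; apply: eq_bigr => x _.
rewrite /E raddf_sum rmorph_sum /= mulr_suml; apply: eq_bigr => i _.
by rewrite raddfMz /= mulrzz intrM mulrA [X in X * _]mulrC.
Qed.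

End Regulator.

(** * Polylogarithms at roots of unity *)

Section Polylog.
Context {R : realType}.

Lemma expr_cis (t : R) n :
  (cos t +i* sin t) ^+ n = cos (n%:R * t) +i* sin (n%:R * t).
Proof.
elim: n => [|n IH]; first by rewrite expr0 mul0r cos0 sin0.
rewrite exprSr IH -natr1 mulrDl mul1r cosD sinD.
by apply/eqP; rewrite eq_complex /= eqxx /= addrC.
Qed.

Lemma sum_complex (I : Type) (s : seq I) (x y : I -> R) :
  \sum_(i <- s) (x i +i* y i) = (\sum_(i <- s) x i) +i* (\sum_(i <- s) y i).
Proof. by elim: s => [|i s IH]; rewrite ?big_nil // !big_cons IH. Qed.

Lemma Li_cis r (t : R) :
  Li r (cos t +i* sin t) =
    limn (fun N : nat => \sum_(1 <= m < N.+1) cos (m%:R * t) / m%:R ^+ r) +i*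
    limn (fun N : nat => \sum_(1 <= m < N.+1) sin (m%:R * t) / m%:R ^+ r).
Proof.
rewrite /Li /climit.
have term m : (cos t +i* sin t) ^+ m / m%:R ^+ r =
    (cos (m%:R * t) / m%:R ^+ r) +i* (sin (m%:R * t) / m%:R ^+ r).
  rewrite expr_cis -(rmorph_nat (real_complex R)) -rmorphXn -fmorphV /=.
  by apply/eqP; rewrite eq_complex /= !mulr0 subr0 add0r !eqxx.
by congr (limn _ +i* limn _); apply/funext => N;
  under eq_bigr do rewrite term; rewrite sum_complex.
Qed.

(** For a divergent sequence both sides are 0, the default value of the limit. *)
Lemma lim_opp (u : nat -> R) : limn (fun N => - u N) = - limn u.
Proof.
have [cu|du] := pselect (cvgn u); first exact: limN.
rewrite (dvgP du) dvgP ?oppr0 //; last by rewrite (@is_cvgNE _ R^o).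
Qed.

End Polylog.

Section PolylogParts.
Context {R : realType}.

(** The trigonometric function with the parity of r, and the other one. *)
Definition same_parity_trig (r : nat) : R -> R := if odd r then sin else cos.
Definition opposite_parity_trig (r : nat) : R -> R := if odd r then cos else sin.

Definition trig_series (g : R -> R) (r : nat) (t : R) : R :=
  limn (fun N : nat => \sum_(1 <= m < N.+1) g (m%:R * t) / m%:R ^+ r).

Lemma shifted_cosE r (y : R) :
  shifted_cos r y = (-1) ^+ r./2 * same_parity_trig r y.
Proof.
rewrite /same_parity_trig.
suff: shifted_cos r y = (-1) ^+ r./2 * (if odd r then sin else cos) y /\
  shifted_cos r.+1 y = (-1) ^+ r.+1./2 * (if odd r.+1 then sin else cos) y by case.
elim: r => [|r [IH1 IH2]] /=; first by rewrite expr0 !mul1r.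
by rewrite negbK IH1 exprS mulN1r mulNr; split.
Qed.

Lemma trig_series_same_parity r (x : R) : (0 < r)%N -> 0 <= x <= 1 ->
    (r = 1%N -> 0 < x < 1) ->
  trig_series (same_parity_trig r) r (2 * pi * x) =
    (-1) ^+ r./2 * - ((2 * pi) ^+ r / (2 * r`!%:R) * (real_bernoulli_poly r).[x]).
Proof.
move=> r0 x01 x1; have := bernoulli_fourier r0 x01 x1.
move=> /(cvgM (cvg_cst ((-1) ^+ r./2 : R))) /cvg_lim <- //.
congr (limn _); apply/funext => N /=; rewrite /trig_sum mulr_sumr.
apply: eq_bigr => m _; rewrite shifted_cosE !mulrA -exprMn mulrNN mulr1 expr1n mul1r.
by congr (same_parity_trig r _ / _); ring.
Qed.

Lemma cosD_turns (y : R) k : cos (y + 2 * pi * k%:R) = cos y.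
Proof. exact: (shifted_cos_periodic 0). Qed.

Lemma sinD_turns (y : R) k : sin (y + 2 * pi * k%:R) = sin y.
Proof. exact: (shifted_cos_periodic 1). Qed.

(** The series of the other parity changes under [x -> 1 - x] by the sign opposite
    to that of f under [a -> - a]. *)
Lemma trig_series_reflect r (t : R) :
  trig_series (opposite_parity_trig r) r (2 * pi - t) =
  - (-1) ^+ r * trig_series (opposite_parity_trig r) r t.
Proof.
have turn m : opposite_parity_trig r (m%:R * (2 * pi - t)) =
    - (-1) ^+ r * opposite_parity_trig r (m%:R * t).
  rewrite /opposite_parity_trig -signr_odd mulrBr.
  have -> : m%:R * (2 * pi) - m%:R * t = - (m%:R * t) + 2 * pi * m%:R :> R by ring.
  case: (odd r).
    by rewrite cosD_turns cosN expr1 opprK mul1r.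
  by rewrite sinD_turns sinN expr0 mulN1r.
rewrite /trig_series.
under eq_fun do under eq_bigr do rewrite turn.
rewrite -signr_odd; case: (odd r).
  rewrite expr1 opprK mul1r; congr (limn _); apply/funext => N.
  by apply: eq_bigr => m _; rewrite mul1r.
rewrite expr0 mulN1r -lim_opp; congr (limn _); apply/funext => N.
by rewrite -sumrN; apply: eq_bigr => m _; rewrite mulN1r mulNr.
Qed.

Lemma trig_series_full_turn r :
  trig_series (opposite_parity_trig r) r (2 * pi) =
  trig_series (opposite_parity_trig r) r 0.
Proof.
rewrite /trig_series; congr (limn _); apply/funext => N.
apply: eq_bigr => m _; congr (_ / _).
rewrite mulr0 -(add0r (_ * _)) [_ * (2 * pi)]mulrC /opposite_parity_trig.
by case: (odd r); rewrite ?cosD_turns ?sinD_turns.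
Qed.

Lemma twopii_expr r : twopii ^+ r =
  (if odd r then 0 +i* ((-1) ^+ r./2 * (2 * pi) ^+ r)
   else ((-1) ^+ r./2 * (2 * pi) ^+ r) +i* 0) :> R[i].
Proof.
suff: forall s, twopii ^+ s.*2 = ((-1) ^+ s * (2 * pi) ^+ s.*2) +i* 0 :> R[i].
  move=> H; have split (A : pzRingType) (u : A) : u ^+ r = u ^+ odd r * u ^+ r./2.*2.
    by rewrite -exprD odd_double_half.
  rewrite !split H; case: (odd r); last by rewrite !expr0 !mul1r.
  rewrite !expr1 /twopii; apply/eqP.
  by rewrite eq_complex /= !mul0r !mulr0 subrr add0r eqxx /= mulrCA.
move=> s; rewrite -!muln2 !(mulnC s) !exprM -exprMn.
have -> : twopii ^+ 2 = (-1 * (2 * pi) ^+ 2) +i* 0 :> R[i].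
  rewrite /twopii !expr2; apply/eqP.
  by rewrite eq_complex /= !mul0r !mulr0 addr0 sub0r mulN1r !eqxx.
rewrite -[in LHS]/((_)%:C) -rmorphXn //.
Qed.

Lemma lincomb_complex (I : finType) (c : I -> int) (x y : I -> R) :
  \sum_i (c i)%:~R * (x i +i* y i) =
  (\sum_i (c i)%:~R * x i) +i* (\sum_i (c i)%:~R * y i).
Proof.
rewrite -sum_complex; apply: eq_bigr => i _.
rewrite -(rmorph_int (real_complex R)); apply/eqP.
by rewrite eq_complex /= !mul0r subr0 addr0 !eqxx.
Qed.

End PolylogParts.

Section PolylogSum.
Context {R : realType} (r l : nat) (f : int -> int).
Context (hr : (0 < r)%N) (hl : (0 < l)%N).
Context (hper : forall a : int, f (a + l%:Z) = f a).
Context (hpar : forall a : int, f (- a) = (-1) ^+ r * f a).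

(** Reversing the sum over 0, ..., l, whose last term is the first one, and that one
    is 0. *)
Lemma sum_antisymmetric (F : nat -> R) :
  (forall a, (a <= l)%N -> F (l - a)%N = - F a) -> F l = F 0%N ->
  \sum_(a < l) F a = 0.
Proof.
move=> anti Fl; have F0 : F 0%N = 0.
  have := anti 0%N (leq0n _); rewrite subn0 Fl => /eqP.
  by rewrite -subr_eq0 opprK -mulr2n mulrn_eq0 => /eqP.
have : \sum_(a < l.+1) F a = - \sum_(a < l.+1) F a.
  rewrite {1}(reindex_inj rev_ord_inj) /= -sumrN.
  by apply: eq_bigr => a _; rewrite subSS anti // -ltnS.
rewrite big_ord_recr /= Fl F0 addr0 => /eqP.
by rewrite -subr_eq0 opprK -mulr2n mulrn_eq0 => /eqP.
Qed.

Lemma sum_opposite_parity :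
  \sum_(a < l) (f a%:Z)%:~R *
    trig_series (opposite_parity_trig r) r (a%:R * (2 * pi / l%:R)) = 0 :> R.
Proof.
have l0 : l%:R != 0 :> R by rewrite pnatr_eq0 -lt0n.
apply: (sum_antisymmetric (F := fun a => (f a%:Z)%:~R *
    trig_series (opposite_parity_trig r) r (a%:R * (2 * pi / l%:R)))) => [a al|].
  have -> : (l - a)%N%:R * (2 * pi / l%:R) = 2 * pi - a%:R * (2 * pi / l%:R) :> R.
    by rewrite natrB //; field.
  rewrite trig_series_reflect -subzn // addrC hper hpar rmorphM rmorphXn /= rmorphN1.
  by rewrite mulrACA mulrN -expr2 sqrr_sign mulN1r.
have -> : l%:R * (2 * pi / l%:R) = 2 * pi :> R by field.
by rewrite mul0r trig_series_full_turn -[l%:Z]add0r hper.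
Qed.

(** This removes the term a = 0 when r = 1, where the sine series does not converge
    to the Bernoulli polynomial and Li_1(1) is divergent. *)
Lemma f0_odd : odd r -> f 0 = 0.
Proof.
move=> ro; have := hpar 0; rewrite oppr0 -signr_odd ro mulN1r => /eqP.
by rewrite -subr_eq0 opprK -mulr2n mulrn_eq0 => /eqP.
Qed.

Lemma sum_same_parity :
  \sum_(a < l) (f a%:Z)%:~R *
    trig_series (same_parity_trig r) r (a%:R * (2 * pi / l%:R)) =
  (-1) ^+ r./2 * - ((2 * pi) ^+ r / (2 * r`!%:R) *
     ratr (\sum_(a < l) (f a%:Z)%:~R * (bernoulli_poly r).[a%:R / l%:R])) :> R.
Proof.
have l0 : 0 < l%:R :> R by rewrite ltr0n.
rewrite rmorph_sum /= mulr_sumr -sumrN mulr_sumr; apply: eq_bigr => a _.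
rewrite rmorphM /= rmorph_int.
have [->|fa] := eqVneq (f a%:Z) 0; first by rewrite !(mul0r, mulr0) oppr0 mulr0.
have -> : a%:R * (2 * pi / l%:R) = 2 * pi * (a%:R / l%:R) :> R.
  by field; rewrite gt_eqF.
rewrite trig_series_same_parity //; first last.
- move=> r1; have a0 : (0 < a)%N.
    rewrite lt0n; apply: contraNneq fa => ->; apply/eqP; apply: f0_odd.
    by rewrite r1.
  by rewrite divr_gt0 ?ltr0n //= ltr_pdivrMr // mul1r ltr_nat.
- by rewrite divr_ge0 //= ler_pdivrMr // mul1r ler_nat ltnW.
have -> : a%:R / l%:R = ratr (a%:R / l%:R) :> R by rewrite fmorph_div /= !ratr_nat.
by rewrite /real_bernoulli_poly horner_map /=; ring.
Qed.

Lemma sum_polylog :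
  \sum_(a < l) (f a%:Z)%:~R * Li r (zeta_root l ^+ a) =
  - (twopii ^+ r / (2 * r`!%:R) *
     ratr (\sum_(a < l) (f a%:Z)%:~R * (bernoulli_poly r).[a%:R / l%:R])) :> R[i].
Proof.
under eq_bigr => a _ do rewrite /zeta_root expr_cis Li_cis.
rewrite lincomb_complex.
set q := \sum_(a < l) _ * (bernoulli_poly r).[_].
have := sum_same_parity; have := sum_opposite_parity; rewrite -/q.
rewrite -(fmorph_rat (real_complex R)).
have -> : 2 * r`!%:R = real_complex R (2 * r`!%:R) by rewrite rmorphM !rmorph_nat.
rewrite -fmorphV twopii_expr.
rewrite /same_parity_trig /opposite_parity_trig /trig_series.
case: (odd r) => -> ->; apply/eqP.
  by rewrite eq_complex /= !(mulr0, mul0r, subr0, addr0, add0r, oppr0) eqxx /= mulrN !mulrA.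
by rewrite eq_complex /= !(mulr0, mul0r, subr0, addr0, add0r, oppr0) eqxx andbT mulrN !mulrA.
Qed.

End PolylogSum.

(** * Torsion in C modulo periods *)

Section Torsion.
Context {R : realType}.

Lemma twopii_neq0 : twopii != 0 :> R[i].
Proof. by rewrite eq_complex /= eqxx /= mulf_neq0 ?pnatr_eq0 // gt_eqF // pi_gt0. Qed.

Lemma mulrn_int_denq (q : rat) (m : nat) :
  (exists N : int, q *+ m = N%:~R) <-> (`|denq q|%N %| m)%N.
Proof.
split=> [[N qN]|/dvdnP[c ->]].
  have : numq q * m%:Z = N * denq q.
    apply: (@intr_inj rat); rewrite !rmorphM /= -qN numqE mulrnAl.
    exact: mulr_natr.
  move=> /(congr1 absz); rewrite !abszM absz_nat => e.
  have := dvdn_mull `|N|%N (dvdnn `|denq q|%N); rewrite -e Gauss_dvdr //.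
  by rewrite coprime_sym coprime_num_den.
exists (c%:Z * numq q).
rewrite mulnC mulrnA rmorphM /= numqE -[LHS]mulr_natl; congr (_ * _).
by rewrite -[LHS]mulr_natr -[in RHS]absz_denq.
Qed.

(** [m x] is a period exactly when [m q] is an integer. *)
Lemma torsion_of_order_rational (r : nat) (x : R[i]) (q : rat) (N : int) :
  x = (N%:~R - ratr q) * twopii ^+ r -> torsion_of_order r x `|denq q|%N.
Proof.
move=> xE; split; first by rewrite absz_gt0 denq_neq0.
move=> m; rewrite -mulrn_int_denq /eq_mod_periods subr0 xE.
have p0 : twopii ^+ r != 0 :> R[i] by rewrite expf_neq0 // twopii_neq0.
split=> [[M]|[M qM]].
  rewrite -mulrnAl => /(mulIf p0) e; exists (N *+ m - M).
  apply: (fmorph_inj (ratr : {rmorphism rat -> R[i]})).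
  rewrite rmorphMn /= ratr_int rmorphB /= -e rmorphMn /= mulrnBl opprB addrC subrK //.
exists (N *+ m - M); rewrite -mulrnAl; congr (_ * _).
by rewrite mulrnBl rmorphB rmorphMn /= -(rmorphMn (ratr : {rmorphism rat -> R[i]})) /= qM ratr_int.
Qed.

End Torsion.

(** * Regulator of the combined cycle *)

Theorem proposition5p2 (R : realType) (r l : nat) (hr : (0 < r)%N) (hl : (0 < l)%N)
    (* k is the subfield Q(e^(2 pi i / l)) of C, embedded by iota *)
    (k : fieldExtType rat) (iota : {rmorphism k -> R[i]}) (z : k)
    (hz : iota z = zeta_root l) (hk : <<1%VS; z>>%VS = fullv)
    (Zc : 'I_l -> cubical_cycle k (2 * r - 1))
    (hZ : forall a : 'I_l, in_NR iota r (Zc a))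
    (hclosed : forall a : 'I_l, cyc_closed (Zc a))
    (hreg : forall a : 'I_l,
       eq_mod_periods r (regulator iota (Zc a))
         ((r.-1)`!%:R * l%:R ^+ (r - 1) * Li r (zeta_root l ^+ a)))
    (* f is a function on Z/lZ *)
    (f : int -> int) (hper : forall a : int, f (a + l%:Z) = f a)
    (hpar : forall a : int, f (- a) = (-1) ^+ r * f a) :
  let Z : cubical_cycle k (2 * r - 1) := \sum_(a < l) Zc a *~ f a%:Z in
  let tau : rat := l%:R ^+ (r - 1) / (2 * r%:R)
    * \sum_(a < l) (f a%:Z)%:~R * (bernoulli_poly r).[a%:R / l%:R] in
  torsion_of_order r (regulator iota Z) `|denq tau|%N
  /\ exists (e : bool) (N : int),
       regulator iota Z / twopii ^+ r = (-1) ^+ e * ratr tau + N%:~R.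
Proof.
move=> Z tau.
have [N hN] := choice hreg.
pose M : int := \sum_(a < l) f a%:Z * N a.
have regZ : regulator iota Z = (M%:~R - ratr tau) * twopii ^+ r.
  rewrite /Z regulator_lincomb.
  have -> : \sum_(a < l) (f a%:Z)%:~R * regulator iota (Zc a) =
      (r.-1)`!%:R * l%:R ^+ (r - 1) *
        \sum_(a < l) (f a%:Z)%:~R * Li r (zeta_root l ^+ a) + M%:~R * twopii ^+ r.
    rewrite mulr_sumr /M rmorph_sum mulr_suml -big_split /=; apply: eq_bigr => a _.
    have /eqP := hN a; rewrite subr_eq => /eqP ->.
    by rewrite rmorphM /=; ring.
  rewrite (sum_polylog hr hl hper hpar) /tau rmorphM /= mulrBl mulrN addrC; congr (_ - _).
  rewrite rmorphM rmorphXn fmorphV rmorphM /= !rmorph_nat.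
  have -> : r`! = (r * (r.-1)`!)%N by case: (r) hr.
  have r0 : r%:R != 0 :> R[i] by rewrite pnatr_eq0 -lt0n.
  have f0 : (r.-1)`!%:R != 0 :> R[i] by rewrite pnatr_eq0 -lt0n fact_gt0.
  by rewrite natrM; field; rewrite r0 f0.
split; first exact: torsion_of_order_rational regZ.
exists true, M; rewrite regZ mulfK ?expf_neq0 ?twopii_neq0 //.
by rewrite expr1 mulN1r addrC.
Qed.
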